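(* Let $q\ge2$ be an integer, let $\{X_n\}_{n\ge1}$ be a stationary stochastic process with state space $\{0,\ldots,q-1\}$, and assume that the cumulative distribution function $F$ of $X=\sum_{n=1}^\infty X_nq^{-n}$ is singular continuous. For $m=1,2,\ldots$, let $\{X_n^{(m)}\}_{n\ge1}$ be the stationary Markov chain of order $m-1$ with state space $\{0,\ldots,q-1\}$ such that $(X_1,\ldots,X_m)$ and $(X_1^{(m)},\ldots,X_m^{(m)})$ are identically distributed, and let $F^{(m)}$ be the CDF of $(0.X_1^{(m)}X_2^{(m)}\ldots)_q$. Then $$\lim_{m\to\infty}\ \sup_{x\in[0,1]}|F(x)-F^{(m)}(x)|=0.$$
   Context: Stationary means that $\{X_n\}_{n\ge1}$ and $\{X_n\}_{n\ge2}$ are identically distributed. $F(x)=\mathrm P(X\le x)$, and $(0.x_1x_2\ldots)_q=\sum_{n=1}^\infty x_nq^{-n}$. A function $F:\mathbb R\to\mathbb R$ is singular if $F'(x)$ exists and equals $0$ for Lebesgue almost every $x\in\mathbb R$; it is singular continuous if it is both singular and continuous. A process is a Markov chain of order $m-1$ if its variables are independent when $m=1$, and, when $m>1$, the conditional distribution of the $n$th variable given all previous ones depends only on the $m-1$ immediately preceding ones, for all $n\ge m$. The chain $\{X^{(m)}_n\}_{n\ge1}$ has, for $n\ge m$, finite dimensional probabilities $$\mathrm P(X_1^{(m)}=x_1,\ldots,X_n^{(m)}=x_n)=\pi(x_1,\ldots,x_{m-1})\prod_{j=m}^n\pi_{x_{j-m+1},\ldots,x_j},$$ where $\pi(x_1,\ldots,x_{m-1})=\mathrm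 P(X_1=x_1,\ldots,X_{m-1}=x_{m-1})$ (equal to $1$ if $m=1$) and $\pi_{x_1,\ldots,x_m}=\mathrm P(X_m=x_m\mid X_1=x_1,\ldots,X_{m-1}=x_{m-1})$ (equal to $\mathrm P(X_1=x_1)$ if $m=1$; the values for conditioning events of probability zero are immaterial). *)

(* Defs.v *)
From HB Require Import structures.
From mathcomp Require Import all_boot all_order all_algebra.
From mathcomp Require Import all_classical all_reals all_analysis measurable_realfun.

Set Implicit Arguments.
Unset Strict Implicit.
Unset Printing Implicit Defensive.

Import Order.TTheory GRing.Theory Num.Theory.
Import numFieldNormedType.Exports.

Local Open Scope classical_set_scope.
Local Open Scope ring_scope.

(* Throughout, processes are indexed from 0: [X n] stands for X_{n+1}. The
   states 0, ..., q-1 are elements of [nat] with its discrete sigma-algebra. *)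

(* Product sigma-algebra on sequences. *)
Definition seq_measurable d (S : measurableType d) : set (set (nat -> S)) :=
  <<s [set A | exists i, exists2 B : set S,
                 measurable B & A = (fun x : nat -> S => x i) @^-1` B] >>.

Definition stationary d d' (T : measurableType d) (S : measurableType d')
    (R : realType) (P : probability T R) (X : nat -> {RV P >-> S}) : Prop :=
  forall A : set (nat -> S), seq_measurable A ->
    P [set w | A (fun n => X n w)] = P [set w | A (fun n => X n.+1 w)].

Definition independent_RVs d d' (T : measurableType d) (S : measurableType d')
    (R : realType) (P : probability T R) (X : nat -> {RV P >-> S}) : Prop :=
  forall (J : seq nat) (B : nat -> set S), uniq J ->
    (forall i, i \in J -> measurable (B i)) ->
    P [set w | forall i, i \in J -> B i (X i w)] =
    (\prod_(i <- J) P (X i @^-1` B i))%E.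

(* Equal to 0 when [B] is a null event. *)
Definition cond_prob d (T : measurableType d) (R : realType)
    (P : probability T R) (A B : set T) : R :=
  fine (P (A `&` B)) / fine (P B).

(* The event that [X i = x i] for all [a <= i < b]. *)
Definition block d (T : measurableType d) (R : realType)
    (P : probability T R) (X : nat -> {RV P >-> nat}) (x : nat -> nat)
    (a b : nat) : set T :=
  [set w | forall i, (a <= i < b)%N -> X i w = x i].

Definition markov_chain_of_order d (T : measurableType d) (R : realType)
    (P : probability T R) (k : nat) (X : nat -> {RV P >-> nat}) : Prop :=
  if k == 0 then independent_RVs X else
  forall (n : nat) (x : nat -> nat), (k <= n)%N -> (0 < P (block X x 0 n))%E ->
    cond_prob P (X n @^-1` [set x n]) (block X x 0 n) =
    cond_prob P (X n @^-1` [set x n]) (block X x (n - k) n).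

Definition same_law_first d1 d2 d' (T1 : measurableType d1)
    (T2 : measurableType d2) (S : measurableType d') (R : realType)
    (P1 : probability T1 R) (P2 : probability T2 R) (m : nat)
    (X : nat -> {RV P1 >-> S}) (Y : nat -> {RV P2 >-> S}) : Prop :=
  forall A : set (m.-tuple S), measurable A ->
    P1 [set w | A [tuple X i w | i < m]] = P2 [set w | A [tuple Y i w | i < m]].

Definition state_space d (T : measurableType d) (R : realType)
    (P : probability T R) (q : nat) (X : nat -> {RV P >-> nat}) : Prop :=
  forall n w, (X n w < q)%N.

(* (0.x_1x_2...)_q; the series converges when all digits are < q. *)
Definition base_expansion (R : realType) (q : nat) (x : nat -> nat) : R :=
  limn (series (fun n => (x n)%:R / q%:R ^+ n.+1 : R)).

Lemma base_expansion_fine (R : realType) (q : nat) (x : nat -> nat) :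
  base_expansion R q x =
  fine (\sum_(0 <= n <oo) ((x n)%:R / q%:R ^+ n.+1 : R)%:E)%E.
Proof.
rewrite /base_expansion; set u := fun n => _.
have u0 n : 0 <= u n by rewrite divr_ge0// exprn_ge0.
have [cu|dvg] := pselect (cvgn (series u)).
  suff -> : (\sum_(0 <= n <oo) (u n)%:E)%E = (limn (series u))%:E by [].
  by rewrite -EFin_lim//; congr (limn _); apply/funext => n /=; rewrite sumEFin.
rewrite dvgP//.
case E : (\sum_(0 <= n <oo) (u n)%:E)%E => [r| |] //=; exfalso; apply: dvg.
have : (fun n => (series u n)%:E) @ \oo --> r%:E.
  rewrite -E; rewrite (_ : (fun n => _) = fun n => (\sum_(0 <= k < n) (u k)%:E)%E).
    by apply: is_cvg_nneseries => n _ _; rewrite lee_fin.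
  by apply/funext => n; rewrite sumEFin.
by move=> /fine_cvg/= h; apply/cvg_ex; exists r.
Qed.

Definition expansion d (T : measurableType d) (R : realType)
    (P : probability T R) (q : nat) (X : nat -> {RV P >-> nat}) : T -> R :=
  fun w => base_expansion R q (fun n => X n w).

Lemma measurable_expansion d (T : measurableType d) (R : realType)
    (P : probability T R) (q : nat) (X : nat -> {RV P >-> nat}) :
  measurable_fun [set: T] (expansion q X).
Proof.
rewrite (_ : expansion q X = fine \o (fun w =>
  (\sum_(0 <= n <oo) ((X n w)%:R / q%:R ^+ n.+1 : R)%:E)%E)); last first.
  by apply/funext => w; exact: base_expansion_fine.
apply: (measurableT_comp (@fine_measurable R [set: \bar R] measurableT)).
apply: ge0_emeasurable_sum => [n w _ _|n _].
  by rewrite lee_fin divr_ge0// exprn_ge0.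
apply/measurable_EFinP; apply: measurable_funM => //.
exact: (@measurableT_comp _ _ _ _ _ _ (fun i : nat => (i%:R : R)) _ (X n)).
Qed.

HB.instance Definition _ d (T : measurableType d) (R : realType)
    (P : probability T R) (q : nat) (X : nat -> {RV P >-> nat}) :=
  isMeasurableFun.Build _ _ _ _ (expansion q X) (measurable_expansion q X).

Definition expansion_cdf d (T : measurableType d) (R : realType)
    (P : probability T R) (q : nat) (X : nat -> {RV P >-> nat}) : R -> R :=
  fun x => fine (cdf (expansion q X : {RV P >-> R}) x).

Definition singular (R : realType) (F : R -> R) : Prop :=
  {ae @lebesgue_measure R, forall x, derivable F x 1 /\ (F^`() x)%classic = 0}.

Definition singular_continuous (R : realType) (F : R -> R) : Prop :=
  singular F /\ continuous F.

(* Main.v *)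
(** Let S_m be the m-digit truncation of the expansion; it differs from the
    full expansion by at most d = q^-m, and has the same law for X as for X^(m).
    Hence F(x - d) <= P(S_m <= x - d) <= F^(m)(x) <= P(S_m <= x) <= F(x + d),
    and the same bounds hold for F(x), so |F(x) - F^(m)(x)| is at most the
    oscillation F(x + d) - F(x - d), which is uniformly small on [0, 1] by
    compactness. *)
Require Import Defs.
From mathcomp Require Import all_boot all_order all_algebra.
From mathcomp Require Import all_classical all_reals all_analysis measurable_realfun.
From mathcomp Require Import lra.

Set Implicit Arguments.
Unset Strict Implicit.
Unset Printing Implicit Defensive.

Import Order.TTheory GRing.Theory Num.Theory.
Import numFieldNormedType.Exports.

Local Open Scope classical_set_scope.
Local Open Scope ring_scope.

(** A digit is at most [q - 1], so the term of index [n] is at most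
    [(q - 1) / q^(n+1) = q^-n - q^-(n+1)], and these bounds telescope from [m] to [n]. *)
Lemma series_base_expansion_le (R : realType) (q : nat) (x : nat -> nat)
    (m n : nat) : (2 <= q)%N -> (forall n, x n < q)%N -> (m <= n)%N ->
  series (fun n => (x n)%:R / q%:R ^+ n.+1 : R) n <=
  series (fun n => (x n)%:R / q%:R ^+ n.+1) m + (q%:R^-1 ^+ m - q%:R^-1 ^+ n).
Proof.
move=> q2 xq; have q0 : (0 : R) < q%:R by rewrite ltr0n (leq_trans _ q2).
elim: n => [|n IH]; first by rewrite leqn0 => /eqP ->; rewrite subrr addr0.
rewrite leq_eqVlt => /predU1P[->|]; first by rewrite subrr addr0.
rewrite ltnS => /IH{}IH; rewrite seriesSr.
suff : (x n)%:R / q%:R ^+ n.+1 <= q%:R^-1 ^+ n - q%:R^-1 ^+ n.+1 :> R.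
  by move: IH; lra.
rewrite -exprVn exprSr mulrA; set t := _ ^+ n.
have -> : t - t * q%:R^-1 = (q%:R - 1) * t / q%:R.
  by rewrite mulrBl mul1r mulrBl mulrAC divff ?gt_eqF// mul1r.
rewrite ler_pM2r ?invr_gt0// ler_wpM2r ?exprn_ge0 ?invr_ge0 ?ler0n//.
by rewrite lerBrDr natr1 ler_nat.
Qed.

(** The partial sums increase, which gives the lower bound. Dropping [- q^-n] from the telescoped
    estimate leaves a bound uniform in [n], which yields both convergence and the upper bound in the
    limit. *)
Lemma base_expansion_bounds (R : realType) (q : nat) (x : nat -> nat)
    (m : nat) : (2 <= q)%N -> (forall n, x n < q)%N ->
  series (fun n => (x n)%:R / q%:R ^+ n.+1 : R) m <= base_expansion R q x <=
  series (fun n => (x n)%:R / q%:R ^+ n.+1) m + q%:R^-1 ^+ m.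
Proof.
move=> q2 xq; rewrite /base_expansion; set u := fun n => _.
have ndu : nondecreasing_seq (series u).
  apply/nondecreasing_seqP => n; rewrite seriesSr lerDl.
  by rewrite divr_ge0 ?exprn_ge0 ?ler0n.
have ub k n : (k <= n)%N -> series u n <= series u k + q%:R^-1 ^+ k.
  move=> kn; rewrite (le_trans (series_base_expansion_le _ q2 xq kn))//.
  by rewrite lerD2l lerBlDr lerDl exprn_ge0 ?invr_ge0 ?ler0n.
have cu : cvgn (series u).
  apply: nondecreasing_is_cvgn => //.
  by exists (series u 0 + q%:R^-1 ^+ 0) => _ [n _ <-]; exact: ub.
apply/andP; split; first exact: nondecreasing_cvgn_le.
apply: limr_le => //; near=> n; apply: ub; near: n; exact: nbhs_infty_ge.
Unshelve. all: by end_near. Qed.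

Section first_digits.
Context (R : realType) (q : nat) (d : measure_display) (T : measurableType d)
  (P : probability T R) (X : nat -> {RV P >-> nat}).

Definition digits_cdf (m : nat) (x : R) : R :=
  fine (P [set w | series (fun n => (X n w)%:R / q%:R ^+ n.+1) m <= x]).

Lemma measurable_digits m x : measurable
  [set w | series (fun n => (X n w)%:R / q%:R ^+ n.+1 : R) m <= x].
Proof.
have mf : measurable_fun [set: T]
    (fun w => series (fun n => (X n w)%:R / q%:R ^+ n.+1 : R) m).
  apply: measurable_sum => n; apply: measurable_funM => //.
  exact: (@measurableT_comp _ _ _ _ _ _ (fun i : nat => (i%:R : R)) _ (X n)).
rewrite -[X in measurable X]setTI.
exact: (mf measurableT _ (measurable_itv `]-oo, x])).
Qed.

Lemma measurable_expansion_le x :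
  measurable [set w | expansion (R:=R) q X w <= x].
Proof.
rewrite -[X in measurable X]setTI.
exact: (measurable_expansion q X measurableT (measurable_itv `]-oo, x])).
Qed.

Lemma expansion_cdfE x :
  expansion_cdf q X x = fine (P [set w | expansion q X w <= x]).
Proof. by []. Qed.

Lemma expansion_cdf_le_digits_cdf m x : (2 <= q)%N -> state_space q X ->
  expansion_cdf q X x <= digits_cdf m x.
Proof.
move=> q2 Xq; have mE := measurable_expansion_le; have mD := measurable_digits.
rewrite expansion_cdfE fine_le ?fin_num_measure//.
apply: le_measure; rewrite ?inE// => w /=; apply: le_trans.
by have /andP[] := base_expansion_bounds R m q2 (Xq ^~ w).
Qed.

Lemma digits_cdf_le_expansion_cdf m x : (2 <= q)%N -> state_space q X ->
  digits_cdf m x <= expansion_cdf q X (x + q%:R^-1 ^+ m).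
Proof.
move=> q2 Xq; have mE := measurable_expansion_le; have mD := measurable_digits.
rewrite expansion_cdfE fine_le ?fin_num_measure//.
apply: le_measure; rewrite ?inE// => w /= h.
have /andP[_ /le_trans] := base_expansion_bounds R m q2 (Xq ^~ w); apply.
by rewrite lerD2r.
Qed.

End first_digits.

(** The truncated sum is a measurable function [f] of the [m]-tuple of first digits, so for both
    processes the event is the preimage of the same measurable set of tuples. *)
Lemma digits_cdf_same_law (R : realType) (q : nat)
    (d : measure_display) (T : measurableType d) (P : probability T R)
    (X : nat -> {RV P >-> nat})
    (d' : measure_display) (T' : measurableType d') (P' : probability T' R)
    (Y : nat -> {RV P' >-> nat}) m x :
  same_law_first m X Y -> digits_cdf q X m x = digits_cdf q Y m x.
Proof.
pose f (t : m.-tuple nat) : R := \sum_(i < m) (tnth t i)%:R / q%:R ^+ i.+1.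
have mf : measurable_fun setT f.
  apply: measurable_sum => i; apply: measurable_funM => //.
  by apply: (@measurableT_comp _ _ _ _ _ _ (fun i : nat => (i%:R : R))) => //;
    exact: measurable_tnth.
have mA : measurable (f @^-1` `]-oo, x]).
  by rewrite -[X in measurable X]setTI; exact: mf.
have digitsE d0 (T0 : measurableType d0) (P0 : probability T0 R)
    (Z : nat -> {RV P0 >-> nat}) :
    [set w | series (fun n => (Z n w)%:R / q%:R ^+ n.+1 : R) m <= x] =
    [set w | (f @^-1` `]-oo, x]) [tuple Z i w | i < m]].
  apply: eq_set => w; rewrite seriesEord /= in_itv/= /f.
  by under [in RHS]eq_bigr do rewrite tnth_mktuple.
by move=> /(_ _ mA) law; rewrite /digits_cdf !digitsE law.
Qed.

(** The near-covering form of compactness reduces the claim to a local one: around each point of the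
    segment, find a neighbourhood and a rank that work together. The resulting rank is then uniform
    in [x]. *)
Lemma oscillation_near_lt (R : realType) (F : R -> R) (u : R^nat) (e : R) :
  continuous F -> u @ \oo --> (0 : R) -> 0 < e ->
  \forall m \near \oo, forall x, `[0, 1]%classic x ->
    F (x + u m) - F (x - u m) < e.
Proof.
move=> cF u0 e0.
have := @segment_compact R 0 1; rewrite compact_near_coveringP.
move=> /(_ _ \oo (fun m x => F (x + u m) - F (x - u m) < e) _); apply => x _.
have [r r0 Fr] : exists2 r : R, 0 < r &
    forall y, `|x - y| < r -> `|F x - F y| < e / 2.
  have /cvgrPdist_lt/(_ (e / 2)) := cF x.
  by rewrite divr_gt0// => /(_ erefl)/nbhs_ballP[r /= r0 h]; exists r.
have r2 : 0 < r / 2 by rewrite divr_gt0.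
(* With [y] within [r / 2] of [x] and a shift below [r / 2], both [y + u m] and [y - u m] stay
   within [r] of [x]; the two errors [e / 2] then add up to [e]. *)
exists (ball x (r / 2), [set m | `|u m| < r / 2]) => /=.
  split; first exact: nbhsx_ballx.
  by have /cvgr0Pnorm_lt/(_ _ r2) := u0.
move=> [y m] /= []; rewrite -ball_normE /= => xy um.
have /Fr : `|x - (y + u m)| < r by move: xy um; rewrite !ltr_norml; lra.
have /Fr : `|x - (y - u m)| < r by move: xy um; rewrite !ltr_norml; lra.
by rewrite !ltr_norml; lra.
Qed.

Theorem proposition3p1 (R : realType) (q : nat)
    (d : measure_display) (T : measurableType d) (P : probability T R)
    (X : nat -> {RV P >-> nat})
    (dm : nat -> measure_display) (Tm : forall m, measurableType (dm m))
    (Pm : forall m, probability (Tm m) R)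
    (Xm : forall m, nat -> {RV (Pm m) >-> nat}) :
  (2 <= q)%N ->
  state_space q X ->
  stationary X ->
  singular_continuous (expansion_cdf q X) ->
  (forall m, (1 <= m)%N ->
     [/\ state_space q (Xm m),
         stationary (Xm m),
         markov_chain_of_order m.-1 (Xm m) &
         same_law_first m X (Xm m)]) ->
  sup [set `|expansion_cdf q X x - expansion_cdf q (Xm m) x| | x in `[0, 1]%classic]
    @[m --> \oo] --> (0 : R).
Proof.
move=> q2 Xq _ [_ cF] XmP.
have u0 : (fun m => q%:R^-1 ^+ m : R) @ \oo --> (0 : R).
  apply: cvg_expr; rewrite ger0_norm ?invr_ge0 ?ler0n//.
  by rewrite invf_lt1 ?ltr1n ?ltr0n // (leq_trans _ q2).
apply/cvgr0Pnorm_le => e e0.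
near=> m.
have m1 : (1 <= m)%N by near: m; exact: nbhs_infty_ge.
have [Xmq _ _ law] := XmP m m1.
set A := (X in sup X).
have A0 : A `|expansion_cdf q X 0 - expansion_cdf q (Xm m) 0|.
  by exists 0 => //=; rewrite in_itv/= lexx ler01.
have Ae : ubound A e.
  move=> _ [x x01 <-].
  have : expansion_cdf q X (x + q%:R^-1 ^+ m) -
      expansion_cdf q X (x - q%:R^-1 ^+ m) < e.
    (* The point [x] is generalized first, since [m] must be chosen independently of it. *)
    move: x x01; near: m; exact: oscillation_near_lt cF u0 e0.
  (* With [d = q^-m], the bounds [h1] to [h6] place both CDFs at [x] between the truncated CDF at
     [x - d] and at [x], and these two values between [F (x - d)] and [F (x + d)]. *)
  have := expansion_cdf_le_digits_cdf m x q2 Xmq.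
  rewrite -(digits_cdf_same_law q x law) => h1.
  have h2 := digits_cdf_le_expansion_cdf m x q2 Xq.
  have h3 := expansion_cdf_le_digits_cdf m (x - q%:R^-1 ^+ m) q2 Xq.
  have := digits_cdf_le_expansion_cdf m (x - q%:R^-1 ^+ m) q2 Xmq.
  rewrite -(digits_cdf_same_law q _ law) subrK => h4.
  have h5 := expansion_cdf_le_digits_cdf m x q2 Xq.
  have h6 := digits_cdf_le_expansion_cdf m (x - q%:R^-1 ^+ m) q2 Xq.
  rewrite subrK in h6.
  by rewrite ler_norml; lra.
(* The member of [A] given by [x = 0] serves twice: it makes [A] nonempty, so that [e] bounds the
   supremum, and, being nonnegative, it bounds the supremum below by 0. *)
rewrite ger0_norm; first by apply: ge_sup => //; eexists; exact: A0.
by apply: le_trans (ub_le_sup _ A0); [exact: normr_ge0|exists e].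
Unshelve. all: by end_near. Qed.
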